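(* Let $K$ be a field, let $\nu : K^* \to \mathbb{Z}$ be a discrete valuation on $K$, and let $R$ be the discrete valuation ring of $\nu$, i.e. $R = \{\alpha \in K : \nu(\alpha) \geq 0\}$. For each integer $n \geq 0$ put $$R_n = \{\alpha \in K : \nu(\alpha) \geq n\}.$$ Then $R$ is a filtered ring with filtration $\{R_n\}_{n \geq 0}$, where $R_0 = R$.
   Context: All rings are commutative with unit. $K^* = K \setminus \{0\}$. A discrete valuation on a field $K$ is a surjective map $\nu : K^* \to \mathbb{Z}$ with $\nu(ab) = \nu(a) + \nu(b)$ and $\nu(a+b) \geq \min\{\nu(a), \nu(b)\}$ (whenever $a+b \neq 0$). By convention $\nu(0) = \infty$, where $\infty \geq n$ for all $n \in \mathbb{Z}$, so that $0 \in R_n$ for every $n$. A filtration on a ring $R$ is a family $\{R_n\}_{n \geq 0}$ of additive subgroups of $R$ such that: (i) $R_0 = R$; (ii) $R_{n+1} \subseteq R_n$ for all $n \geq 0$; (iii) $R_n R_m \subseteq R_{n+m}$ for all $n, m \geq 0$, where $R_n R_m$ denotes the set of finite sums $\sum_i a_i b_i$ with $a_i \in R_n$, $b_i \in R_m$. A ring together with a filtration is called a filtered ring. *)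

(* Defs.v *)
From HB Require Import structures.
From mathcomp Require Import all_boot all_order all_algebra.
Set Implicit Arguments.
Unset Strict Implicit.
Unset Printing Implicit Defensive.
Import Order.TTheory GRing.Theory Num.Theory.
Local Open Scope ring_scope.

(* A map K^* -> Z is encoded as a total function K -> int whose value at 0 is
   never used: every clause is restricted to nonzero arguments. *)
Record discrete_valuation (K : fieldType) (nu : K -> int) : Prop :=
  DiscreteValuation {
    dval_surj : forall m : int, exists2 a : K, a != 0 & nu a = m;
    dvalM : forall a b : K, a != 0 -> b != 0 -> nu (a * b) = nu a + nu b;
    dvalD : forall a b : K, a != 0 -> b != 0 -> a + b != 0 ->
      Num.min (nu a) (nu b) <= nu (a + b)
  }.

(* nu(a) >= m, with the convention nu(0) = oo. *)
Definition dval_ge (K : fieldType) (nu : K -> int) (m : int) (a : K) : bool :=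
  (a == 0) || (m <= nu a).

Definition dval_ring (K : fieldType) (nu : K -> int) : {pred K} :=
  [pred a | dval_ge nu 0 a].

Definition dval_filtration (K : fieldType) (nu : K -> int) (n : nat) :
    {pred K} :=
  [pred a | dval_ge nu n%:Z a].

(* x lies in the set of finite sums of products a * b, a in S, b in T. *)
Definition in_prod_set (A : comPzRingType) (S T : {pred A}) (x : A) : Prop :=
  exists (k : nat) (a b : 'I_k -> A),
    [/\ forall i, a i \in S, forall i, b i \in T & x = \sum_(i < k) a i * b i].

(* Rings are given as subrings R of an ambient commutative ring A, with the
   inherited operations, and the terms F n as subsets of A contained in R.
   A filtration on A itself is the case R = A. *)
Record filtration (A : comPzRingType) (R : {pred A}) (F : nat -> {pred A}) :
    Prop := Filtration {
    filtration_sub : forall n, {subset F n <= R};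
    filtration_zmod : forall n, zmod_closed (F n);
    filtration0 : F 0%N =i R;
    filtrationS : forall n, {subset F n.+1 <= F n};
    filtrationM : forall n m x,
      in_prod_set (F n) (F m) x -> x \in F (n + m)%N
  }.

Definition filtered_ring (A : comPzRingType) (R : {pred A})
    (F : nat -> {pred A}) : Prop :=
  subring_closed R /\ filtration R F.

(* Main.v *)
Require Import Defs.
From HB Require Import structures.
From mathcomp Require Import all_boot all_order all_algebra.
Set Implicit Arguments.
Unset Strict Implicit.
Unset Printing Implicit Defensive.
Import Order.TTheory GRing.Theory Num.Theory.
Local Open Scope ring_scope.

(** Each filtration axiom is one property of the valuation read on the sets [dval_ge nu m]. The
    ultrametric inequality together with nu(-a) = nu(a) makes each set an additive subgroup
    ([dval_geB]). Additivity of nu on products makes the bounds m and n add up ([dval_geM]).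
    Monotonicity in the bound ([dval_geW]) gives the inclusions. That R is a subring is the case of
    bound 0, together with nu(1) = 0. *)

Lemma dval1 (K : fieldType) (nu : K -> int) :
  discrete_valuation nu -> nu 1 = 0.
Proof.
move=> nuP; have := dvalM nuP (oner_neq0 K) (oner_neq0 K).
(* Multiplicativity at [1 * 1] reads [nu 1 + 0 = nu 1 + nu 1]; cancel [nu 1]. *)
by rewrite mulr1 -{1}[nu 1]addr0 => /addrI <-.
Qed.

(** Since (-1)(-1) = 1, twice nu(-1) equals nu(1) = 0, and the integers have no 2-torsion, so nu(-1)
    = 0. *)
Lemma dvalN (K : fieldType) (nu : K -> int) (a : K) :
  discrete_valuation nu -> a != 0 -> nu (- a) = nu a.
Proof.
move=> nuP a0; have N1_neq0 : -1 != 0 :> K by rewrite oppr_eq0 oner_neq0.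
have := dvalM nuP N1_neq0 N1_neq0.
rewrite mulrNN mulr1 (dval1 nuP) -mulr2n => /esym/eqP.
rewrite mulrn_eq0 /= => /eqP nuN1.
by rewrite -mulN1r (dvalM nuP) // nuN1 add0r.
Qed.

Lemma dval_ge_zero (K : fieldType) (nu : K -> int) (m : int) : dval_ge nu m 0.
Proof. by rewrite /dval_ge eqxx. Qed.

Lemma dval_geW (K : fieldType) (nu : K -> int) (m n : int) (a : K) :
  m <= n -> dval_ge nu n a -> dval_ge nu m a.
Proof.
by rewrite /dval_ge => le_mn /orP[->//|/(le_trans le_mn) ->]; rewrite orbT.
Qed.

Lemma dval_geN (K : fieldType) (nu : K -> int) (m : int) (a : K) :
  discrete_valuation nu -> dval_ge nu m (- a) = dval_ge nu m a.
Proof.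
move=> nuP; rewrite /dval_ge oppr_eq0.
by case: eqVneq => //= a0; rewrite dvalN.
Qed.

(** The ultrametric inequality applies once [a], [b] and [a + b] are nonzero; the remaining cases
    rest on the convention nu(0) = oo. *)
Lemma dval_geD (K : fieldType) (nu : K -> int) (m : int) (a b : K) :
  discrete_valuation nu ->
  dval_ge nu m a -> dval_ge nu m b -> dval_ge nu m (a + b).
Proof.
move=> nuP; have [->|a0] := eqVneq a 0; first by rewrite add0r.
have [->|b0] := eqVneq b 0; first by rewrite addr0.
rewrite /dval_ge (negPf a0) (negPf b0) /= => ma mb.
have [//|ab0] := eqVneq (a + b) 0.
by apply: le_trans (dvalD nuP a0 b0 ab0); rewrite le_min ma.
Qed.

Lemma dval_geB (K : fieldType) (nu : K -> int) (m : int) (a b : K) :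
  discrete_valuation nu ->
  dval_ge nu m a -> dval_ge nu m b -> dval_ge nu m (a - b).
Proof. by move=> nuP ma mb; apply: dval_geD => //; rewrite dval_geN. Qed.

Lemma dval_geM (K : fieldType) (nu : K -> int) (m n : int) (a b : K) :
  discrete_valuation nu ->
  dval_ge nu m a -> dval_ge nu n b -> dval_ge nu (m + n) (a * b).
Proof.
move=> nuP; have [->|a0] := eqVneq a 0; first by rewrite mul0r !dval_ge_zero.
have [->|b0] := eqVneq b 0; first by rewrite mulr0 !dval_ge_zero.
rewrite /dval_ge (negPf a0) (negPf b0) mulf_eq0 (negPf a0) (negPf b0) /=.
by rewrite (dvalM nuP) //; apply: lerD.
Qed.

Theorem theorem3p1 (K : fieldType) (nu : K -> int)
    (nuP : discrete_valuation nu) :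
  filtered_ring (dval_ring nu) (dval_filtration nu).
Proof.
split; first split.
- by rewrite inE /dval_ge (dval1 nuP) lexx orbT.
- by move=> a b; rewrite !inE; apply: dval_geB.
(* The bound of the product is written [0 + 0] to match [dval_geM] with both bounds zero. *)
- by move=> a b; rewrite !inE -{3}[0]addr0; apply: dval_geM.
split.
- by move=> n a; rewrite !inE; apply: dval_geW.
- move=> n; split=> [|a b]; rewrite !inE; first exact: dval_ge_zero.
  exact: dval_geB.
- by move=> a; rewrite !inE.
- by move=> n a; rewrite !inE; apply: dval_geW; rewrite lez_nat.
- move=> n m x [k [a [b [Fa Fb ->]]]]; rewrite inE.
  (* R_(n+m) contains 0 and is closed under addition, so a finite sum, possibly empty, reduces to
     single products [a i * b i]. *)
  apply: (big_ind (fun y => dval_ge nu (n + m)%N y)) => [|y z|i _].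
  + exact: dval_ge_zero.
  + exact: dval_geD.
  + by rewrite PoszD; apply: dval_geM; [|apply: Fa|apply: Fb].
Qed.
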